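(* Let $F:\mathbb{R}^n\rightarrow\mathbb{R}^n$ be a piecewise affine function and let $\mathcal P(F)$ be a polyhedral subdivision of $\mathbb{R}^n$ corresponding to $F$. If the linear parts of all selection functions of $F$ which are active on unbounded polyhedra in $\mathcal P(F)$ have the same nonzero determinant sign (i.e. their determinants are all positive or all negative), then $F$ is surjective.
   Context: A continuous function $F:\mathbb{R}^n\rightarrow\mathbb{R}^n$ is piecewise affine if there is a finite set of affine functions $F_i(x)=A_ix+b_i$, called selection functions (with linear part $A_i$), such that for every $x\in\mathbb{R}^n$ one has $F(x)=F_i(x)$ for some $i$. If $F$ coincides with $F_i$ on a set $U$, then $F_i$ is said to be active on $U$. A polyhedral subdivision $\mathcal P(F)$ corresponding to $F$ is a finite collection of $n$-dimensional convex polyhedra covering $\mathbb{R}^n$ such that: (1) for every $P\in\mathcal P(F)$ there is a selection function $F_i$ with $F|_P=F_i|_P$; (2) the intersection of two distinct polyhedra $P,Q\in\mathcal P(F)$ is either empty or a common proper face of $P$ and $Q$; (3) if $P\cap Q\neq\emptyset$, the selection functions active on $P$ and on $Q$ coincide on $P\cap Q$. Since each polyhedron is $n$-dimensional, the selection function active on it is uniquely determined. Every piecewise affine function admits such a (nonunique) subdivision. *)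

(* Defs.v *)
From mathcomp Require Import all_boot all_order all_algebra.
From mathcomp Require Import all_classical all_reals all_analysis.

Set Implicit Arguments.
Unset Strict Implicit.
Unset Printing Implicit Defensive.

Import Order.TTheory GRing.Theory Num.Theory.
Import numFieldNormedType.Exports.

Local Open Scope classical_set_scope.
Local Open Scope ring_scope.

Definition affine_fun (R : realType) (n : nat) (A : 'M[R]_n) (b : 'cV[R]_n)
    : 'cV[R]_n -> 'cV[R]_n :=
  fun x => A *m x + b.

(* The selection functions are F_i x = A i *m x + b i, for i < m. *)
Definition piecewise_affine (R : realType) (n m : nat)
    (F : 'cV[R]_n -> 'cV[R]_n) (A : 'I_m -> 'M[R]_n) (b : 'I_m -> 'cV[R]_n)
    : Prop :=
  continuous F /\ forall x, exists i, F x = affine_fun (A i) (b i) x.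

Definition active_on (R : realType) (n : nat)
    (F f : 'cV[R]_n -> 'cV[R]_n) (U : set 'cV[R]_n) : Prop :=
  {in U, F =1 f}.

Definition dotv (R : realType) (n : nat) (a x : 'cV[R]_n) : R :=
  \sum_(j < n) a j 0 * x j 0.

Definition is_polyhedron (R : realType) (n : nat) (P : set 'cV[R]_n) : Prop :=
  exists (k : nat) (a : 'I_k -> 'cV[R]_n) (beta : 'I_k -> R),
    P = [set x | forall i, dotv (a i) x <= beta i].

(* a = 0 is allowed, so that P and the empty set are faces of P. *)
Definition is_face (R : realType) (n : nat) (G P : set 'cV[R]_n) : Prop :=
  exists (a : 'cV[R]_n) (beta : R),
    P `<=` [set x | dotv a x <= beta] /\ G = P `&` [set x | dotv a x = beta].

Definition is_proper_face (R : realType) (n : nat) (G P : set 'cV[R]_n)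
    : Prop :=
  is_face G P /\ G <> P.

Definition affinely_independent (R : realType) (n k : nat)
    (x : 'I_k.+1 -> 'cV[R]_n) : bool :=
  row_free (\matrix_(i < k) (x (lift ord0 i) - x ord0)^T).

(* d + 1 is the largest number of affinely independent points of P; no d is
   the dimension of the empty set. *)
Definition has_dimension (R : realType) (n : nat) (P : set 'cV[R]_n) (d : nat)
    : Prop :=
  (exists x : 'I_d.+1 -> 'cV[R]_n,
      (forall i, P (x i)) /\ affinely_independent x) /\
  (forall (k : nat) (x : 'I_k.+1 -> 'cV[R]_n),
      (forall i, P (x i)) -> affinely_independent x -> (k <= d)%N).

Record polyhedral_subdivision (R : realType) (n m : nat)
    (F : 'cV[R]_n -> 'cV[R]_n) (A : 'I_m -> 'M[R]_n) (b : 'I_m -> 'cV[R]_n)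
    (PP : set (set 'cV[R]_n)) : Prop := {
  subdiv_finite : finite_set PP;
  subdiv_polyhedron : forall P, PP P -> is_polyhedron P;
  subdiv_dimension : forall P, PP P -> has_dimension P n;
  subdiv_cover : \bigcup_(P in PP) P = [set: 'cV[R]_n];
  subdiv_active : forall P, PP P ->
    exists i, active_on F (affine_fun (A i) (b i)) P;
  subdiv_face : forall P Q, PP P -> PP Q -> P <> Q ->
    P `&` Q = set0 \/
    (is_proper_face (P `&` Q) P /\ is_proper_face (P `&` Q) Q);
  (* follows from the definition of [active_on]; part of the usual definition *)
  subdiv_agree : forall P Q, PP P -> PP Q -> P `&` Q !=set0 ->
    forall i j,
      active_on F (affine_fun (A i) (b i)) P ->
      active_on F (affine_fun (A j) (b j)) Q ->
      {in P `&` Q, affine_fun (A i) (b i) =1 affine_fun (A j) (b j)}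
}.

(* Main.v *)
Require Import Defs.
From mathcomp Require Import all_boot all_order all_algebra.
From mathcomp Require Import all_classical all_reals all_analysis.
From mathcomp Require Import ring lra.

(* Suppose F misses y. The image of a generic far away point x0 lies on a line
   through y with direction e, and the preimage of this line is followed along
   the piecewise constant field adj(A_i) e. Across a hyperplane with normal a
   the linear part changes by c a^T, which leaves a^T adj(A_i) unchanged, so a
   trajectory leaving one cell of the hyperplane arrangement transversally
   enters the next one. Moving along the field in a cell moves F along the line
   with speed det(A_i), so a trajectory staying in an unbounded cell backwards
   in time would reach y. Hence on the finite set of cells met by the preimage
   of the open half-line from y through F(x0), the predecessor map is everywhere
   defined and injective, thus a bijection. But beyond F(x0) all cells are
   contained in unbounded polyhedra, where F strictly advances, so the cell
   whose entry point is the farthest along the half-line has no successor. *)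

Set Implicit Arguments.
Unset Strict Implicit.
Unset Printing Implicit Defensive.

Import Order.TTheory GRing.Theory Num.Theory.
Import numFieldNormedType.Exports.

Local Open Scope classical_set_scope.
Local Open Scope ring_scope.

(** * Adjugates, row replacement and rank one updates *)

Section Adjugate.
Variables (R : comNzRingType) (n : nat).
Implicit Types (A : 'M[R]_n) (a : 'rV[R]_n) (c : 'cV[R]_n).

Definition replace_row A (j : 'I_n) a : 'M[R]_n :=
  \matrix_(i, k) if i == j then a 0 k else A i k.

Lemma det_replace_row A j a : \det (replace_row A j a) = (a *m \adj A) 0 j.
Proof.
rewrite (expand_det_row _ j) mxE; apply: eq_bigr => k _.
rewrite !mxE eqxx; congr (_ * (_ * \det _)).
by apply/matrixP => i l; rewrite !mxE eq_sym (negPf (neq_lift _ _)).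
Qed.

(** Sylvester's identity: one block matrix has two block triangular factorizations, which give the
    two determinants. *)
Lemma det_add1mul m (u : 'M[R]_(n, m)) (v : 'M[R]_(m, n)) :
  \det (1%:M + u *m v) = \det (1%:M + v *m u).
Proof.
have E1 : block_mx (1%:M + u *m v) (- u) 0 1%:M *m block_mx 1%:M 0 v 1%:M =
          block_mx 1%:M (- u) v 1%:M.
  rewrite mulmx_block !mulmx1 !mul0mx !mul1mx mulNmx ?mulmx0.
  by rewrite ?add0r addrK.
have E2 : block_mx 1%:M 0 v 1%:M *m block_mx 1%:M (- u) 0 (1%:M + v *m u) =
          block_mx 1%:M (- u) v 1%:M.
  rewrite mulmx_block ?mulmx1 ?mul0mx ?mul1mx mulmxN ?mulmx0 ?addr0.
  by rewrite addrC addrK.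
move: (congr1 determinant E1); rewrite -E2 !det_mulmx !det_ublock !det_lblock.
by rewrite !det1 !mul1r !mulr1.
Qed.

(* Replacing row j by [a] makes [A + c a] and [A] row equivalent: the elementary
   operations add multiples of row j to the other rows. *)
Lemma mul_adj_rank1 A a c : a *m \adj (A + c *m a) = a *m \adj A.
Proof.
apply/rowP => j; rewrite -!det_replace_row.
(* Row [j] is [a] in both matrices, so entry [j] of [c] is dropped; then [delta_mx 0 j *m c']
   vanishes and the multiplier has determinant 1. *)
pose c' : 'cV[R]_n := \col_i if i == j then 0 else c i 0.
suff -> : replace_row (A + c *m a) j a =
    (1%:M + c' *m delta_mx 0 j) *m replace_row A j a.
  rewrite det_mulmx det_add1mul -rowE.
  have -> : row j c' = 0 by apply/rowP => k; rewrite !mxE eqxx.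
  by rewrite addr0 det1 mul1r.
apply/matrixP => i k.
rewrite mulmxDl mul1mx -mulmxA -rowE !mxE !big_ord1 !mxE eqxx.
by case: eqP => _; rewrite ?mul0r ?addr0.
Qed.

End Adjugate.

(** The entries of [a *m \adj A] are determinants of matrices that all kill the nonzero vector
    [w]. *)
Lemma mul_adj_eq0 (F : idomainType) n (A : 'M[F]_n) (a : 'rV_n) (w : 'cV_n) :
  A *m w = 0 -> a *m w = 0 -> w != 0 -> a *m \adj A = 0.
Proof.
move=> Aw aw w0; apply/rowP => j; rewrite -det_replace_row mxE.
rewrite -det_tr; apply/eqP/det0P; exists w^T; first by rewrite trmx_eq0.
rewrite -trmx_mul; apply/eqP; rewrite trmx_eq0; apply/eqP/colP => i.
move: (congr1 (fun B : 'cV[F]_n => B i 0) Aw)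
  (congr1 (fun B : 'M[F]_1 => B 0 0) aw).
rewrite !mxE => Ai a0; case: (eqVneq i j) => ij.
  by rewrite -[RHS]a0; apply: eq_bigr => k _; rewrite !mxE ij eqxx.
by rewrite -[RHS]Ai; apply: eq_bigr => k _; rewrite !mxE (negPf ij).
Qed.

(** * The standard inner product *)

Section Dot.
Variables (R : realType) (n : nat).
Implicit Types (a x y : 'cV[R]_n) (c : R).

Lemma dotvE a x : dotv a x = (a^T *m x) 0 0.
Proof. by rewrite mxE; apply: eq_bigr => j _; rewrite mxE. Qed.

Lemma dotvC a x : dotv a x = dotv x a.
Proof. by apply: eq_bigr => j _; rewrite mulrC. Qed.

Lemma dotvDr a x y : dotv a (x + y) = dotv a x + dotv a y.
Proof. by rewrite !dotvE mulmxDr mxE. Qed.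

Lemma dotvZr a c x : dotv a (c *: x) = c * dotv a x.
Proof. by rewrite !dotvE -scalemxAr mxE. Qed.

Lemma dotvBr a x y : dotv a (x - y) = dotv a x - dotv a y.
Proof. by rewrite dotvDr -scaleN1r dotvZr mulN1r. Qed.

Lemma dotvDl a x y : dotv (x + y) a = dotv x a + dotv y a.
Proof. by rewrite !(dotvC _ a) dotvDr. Qed.

Lemma dotvZl a c x : dotv (c *: x) a = c * dotv x a.
Proof. by rewrite !(dotvC _ a) dotvZr. Qed.

Lemma dotv0l x : dotv 0 x = 0.
Proof. by rewrite -(scale0r x) dotvZl mul0r. Qed.

Lemma dotvv_eq0 x : (dotv x x == 0) = (x == 0).
Proof.
apply/eqP/eqP => [x0|->]; last by rewrite dotv0l.
apply/colP => j; rewrite mxE; apply/eqP.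
have := x0; rewrite /dotv => /eqP; rewrite psumr_eq0 => [/allP/(_ j)|i _].
  by rewrite mem_index_enum mulf_eq0 orbb; apply.
by rewrite -expr2 sqr_ge0.
Qed.

End Dot.

Lemma dotvMr (R : realType) m n (a : 'cV[R]_m) (A : 'M[R]_(m, n)) x :
  dotv a (A *m x) = dotv (A^T *m a) x.
Proof. by rewrite !dotvE trmx_mul trmxK mulmxA. Qed.

(** * Direction fields across a hyperplane *)

Section Crossing.
Variables (R : realType) (n : nat).
Implicit Types (A B : 'M[R]_n) (a e w : 'cV[R]_n).

(* The rank one jump across a hyperplane does not change the normal component
   of the direction field [\adj A *m e]. *)
Lemma dotv_adj_crossing A B a e :
  (forall w, dotv a w = 0 -> A *m w = B *m w) ->
  dotv a (\adj A *m e) = dotv a (\adj B *m e).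
Proof.
move=> AB; have [->|a0] := eqVneq a 0; first by rewrite !dotv0l.
have aa0 : dotv a a != 0 by rewrite dotvv_eq0.
(* [A - B] vanishes on the vectors orthogonal to [a], so its value at [a] determines it. *)
pose c := (dotv a a)^-1 *: ((A - B) *m a).
suff AE : A = B + c *m a^T.
  by rewrite !dotvE !mulmxA AE mul_adj_rank1.
apply/eqP; rewrite addrC -subr_eq; apply/eqP.
suff H w : (A - B) *m w = dotv a w *: c.
  apply/row_matrixP => i; apply/rowP => j.
  have := H (delta_mx j 0); rewrite -colE => /(congr1 (fun v : 'cV[R]_n => v i 0)).
  rewrite !mxE => ->; rewrite big_ord1 !mxE mulrC; congr (_ * _).
  by rewrite dotvE -colE !mxE.
rewrite /c scalerA -{1}(subrK ((dotv a w / dotv a a) *: a) w) mulmxDr -scalemxAr.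
suff -> : (A - B) *m (w - (dotv a w / dotv a a) *: a) = 0 by rewrite add0r.
rewrite mulmxBl AB ?subrr // dotvBr dotvZr mulfVK // subrr //.
Qed.

(** This covers singular [A] as well: a nonzero adjugate forces a kernel of dimension at most
    one. *)
Lemma adj_direction_unique A e w (k : R) :
  \adj A *m e != 0 -> A *m w = k *: e -> exists r, w = r *: (\adj A *m e).
Proof.
set t := \adj A *m e => t0 Aw.
have dw : \det A *: w = k *: t
  by rewrite -mul_scalar_mx -mul_adj_mx -mulmxA Aw scalemxAr.
have [d0|d0] := eqVneq (\det A) 0; last first.
  exists (k / \det A); apply: (scalerI d0).
  by rewrite dw scalerA mulrC divfK.
have [->|w0] := eqVneq w 0; first by exists 0; rewrite scale0r.
have Aw0 : A *m w = 0.
  move/eqP: dw; rewrite d0 scale0r eq_sym scaler_eq0 (negPf t0) orbF => /eqP k0.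
  by rewrite Aw k0 scale0r.
have ww0 : dotv w w != 0 by rewrite dotvv_eq0.
(* The component of [t] orthogonal to [w]; [mul_adj_eq0] makes it orthogonal to [t], hence to
   itself. *)
pose a : 'cV[R]_n := t - (dotv t w / dotv w w) *: w.
have aw : dotv a w = 0.
  by rewrite dotvC dotvBr dotvZr (dotvC w t) mulfVK // subrr.
have aw0 : a^T *m w = 0 by rewrite (mx11_scalar (_ *m _)) -dotvE aw raddf0.
have at0 : dotv a t = 0 by rewrite dotvE mulmxA (mul_adj_eq0 Aw0 aw0 w0) mul0mx mxE.
have : dotv a a == 0.
  by rewrite {2}/a dotvBr dotvZr at0 aw mulr0 subrr.
rewrite dotvv_eq0 subr_eq0 => /eqP tE.
move: tE; set q := _ / _ => tE.
have q0 : q != 0 by apply: contraNneq t0 => q0; rewrite tE q0 scale0r.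
by exists q^-1; rewrite tE scalerA mulVf // scale1r.
Qed.

(* An independent pair of linear constraints cuts out a flat of codimension 2;
   with [y] its affine image spans at most a hyperplane. *)
Lemma flat_image_hyperplane A (b y a1 a2 : 'cV[R]_n) (b1 b2 : R) :
  a1 != 0 -> (forall r, a2 <> r *: a1) ->
  exists2 c : 'cV[R]_n, c != 0 &
    forall x, dotv a1 x = b1 -> dotv a2 x = b2 -> dotv c (A *m x + b) = dotv c y.
Proof.
move=> a10 a12.
(* [M] has one more row than columns, hence a nonzero left kernel vector: its first block gives [c],
   its last two entries are multipliers of the constraints. *)
pose M : 'M[R]_(n + (1 + 1), n + 1) :=
  col_mx (row_mx A (b - y)) (col_mx (row_mx a1^T (- b1)%:M) (row_mx a2^T (- b2)%:M)).
have /rowV0Pn[v /sub_kermxP vM v0] : kermx M != 0.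
  by rewrite kermx_eq0 /row_free neq_ltn (leq_ltn_trans (rank_leq_col _)) // ltn_add2l.
pose c := (lsubmx v)^T.
pose m1 := lsubmx (rsubmx v) 0 0; pose m2 := rsubmx (rsubmx v) 0 0.
have vE : v = row_mx c^T (row_mx m1%:M m2%:M).
  by rewrite trmxK -!mx11_scalar !hsubmxK.
have comb x k : dotv c (A *m x + k *: (b - y)) + m1 * (dotv a1 x - k * b1)
    + m2 * (dotv a2 x - k * b2) = 0.
  have := congr1 (fun B : 'M[R]_(1, n + 1) => (B *m col_mx x k%:M) 0 0) vM.
  rewrite vE mul0mx -mulmxA !mul_col_mx !mul_row_col !mul_mx_scalar !mul_scalar_mx.
  have mxD (B C : 'M[R]_1) : (B + C) 0 0 = B 0 0 + C 0 0 by rewrite mxE.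
  have mxZ r (B : 'M[R]_1) : (r *: B) 0 0 = r * B 0 0 by rewrite mxE.
  have mxS r : (r%:M : 'M[R]_1) 0 0 = r by rewrite mxE eqxx.
  by rewrite !(mxD, mxZ, mxS) -!dotvE mxE !mulrN addrA.
exists c => [|x x1 x2].
  apply/eqP => c0.
  have m12 : m1 *: a1 + m2 *: a2 = 0.
    apply/eqP; rewrite -dotvv_eq0 dotvDl !dotvZl.
    by have := comb (m1 *: a1 + m2 *: a2) 0; rewrite c0 dotv0l !mul0r !subr0 add0r => ->.
  have m20 : m2 = 0.
    apply: contra_notP (a12 (- (m1 / m2))) => /eqP m20.
    apply: (scalerI m20); rewrite scalerA mulrN mulrCA divff // mulr1 scaleNr.
    by apply/eqP; rewrite -addr_eq0 addrC m12.
  have m10 : m1 = 0.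
    by move/eqP: m12; rewrite m20 scale0r addr0 scaler_eq0 (negPf a10) orbF => /eqP.
  by move/eqP: v0; apply; rewrite vE c0 m10 m20 trmx0 !raddf0 !row_mx0.
have := comb x 1; rewrite scale1r addrA dotvBr x1 x2 !mul1r !subrr !mulr0 !addr0.
by move/eqP; rewrite subr_eq0 => /eqP.
Qed.

End Crossing.

(** * Small perturbations and generic choices *)

Lemma exists_gt_seq (R : realDomainType) (s : seq R) :
  exists r, forall x, x \in s -> x < r.
Proof.
elim: s => [|z s [r rP]]; first by exists 0.
exists (Num.max r (z + 1)) => x; rewrite inE lt_max => /predU1P[->|/rP->//].
by rewrite ltrDl ltr01 orbT.
Qed.

Lemma small_perturbation (R : realFieldType) (I : finType) (u v : I -> R) :
  (forall i, 0 < u i) ->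
  exists2 d, 0 < d & forall i r, 0 <= r <= d -> 0 < u i + r * v i.
Proof.
move=> u0; have [q qP] := exists_gt_seq (0 :: [seq `|v i| / u i | i <- enum I]).
have q0 : 0 < q by apply: qP; rewrite inE eqxx.
exists q^-1 => [|i r /andP[r0 rq]]; first by rewrite invr_gt0.
have : `|v i| / u i < q by apply: qP; rewrite inE (map_f (fun i => _)) ?mem_enum ?orbT.
rewrite ltr_pdivrMr // => vq.
have : r * `|v i| < u i.
  have [->|v0] := eqVneq (v i) 0; first by rewrite normr0 mulr0.
  apply: (le_lt_trans (ler_wpM2r (normr_ge0 _) rq)).
  by rewrite mulrC ltr_pdivrMr // mulrC.
have : - (r * `|v i|) <= r * v i.
  by rewrite -mulrN ler_wpM2l // lerNl ler_normr lexx orbT.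
lra.
Qed.

(** By induction: [r] exceeds the only bad value for each [c] with [dotv c d] nonzero, and
    [dotv c d] can vanish only for [c0], which is not orthogonal to itself. *)
Lemma generic_direction (R : realType) n (cs : seq 'cV[R]_n) :
  (forall c, c \in cs -> c != 0) ->
  exists d, forall c, c \in cs -> dotv c d != 0.
Proof.
elim: cs => [|c0 cs IH] cs0; first by exists 0.
have [c|d dP] := IH; first by move=> ccs; apply: cs0; rewrite inE ccs orbT.
have [r rP] := exists_gt_seq [seq - (dotv c c0 / dotv c d) | c <- c0 :: cs].
exists (c0 + r *: d) => c ccs; rewrite dotvDr dotvZr.
have [cd0|cd0] := eqVneq (dotv c d) 0.
  move: (ccs); rewrite cd0 mulr0 addr0 inE => /predU1P[->|/dP].
    by rewrite dotvv_eq0 cs0 // inE eqxx.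
  by rewrite cd0 eqxx.
have := rP _ (map_f (fun c => - (dotv c c0 / dotv c d)) ccs).
apply: contraTneq => /eqP; rewrite addrC addr_eq0 => /eqP/(canRL (mulfK cd0)) ->.
by rewrite mulNr ltxx.
Qed.

Lemma generic_point (R : realType) n (I : finType) (c : I -> 'cV[R]_n.+1)
    (g : I -> R) (N : R) :
  exists2 x : 'cV[R]_n.+1, N < `|x| &
    forall i, c i != 0 -> dotv (c i) x != g i.
Proof.
have [|d dP] := @generic_direction R n.+1
    (* [const_mx 1] forces [d] to be nonzero, so that its large multiples have large norm. *)
    (const_mx 1 :: [seq c i | i <- enum I & c i != 0]).
  move=> u; rewrite inE => /predU1P[->|/mapP[i + ->]]; last first.
    by rewrite mem_filter => /andP[].
  by apply/eqP => /colP/(_ 0)/eqP; rewrite !mxE oner_eq0.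
have d0 : 0 < `|d|.
  rewrite normr_gt0; apply: contraNneq (dP (const_mx 1) (mem_head _ _)) => ->.
  by rewrite dotvC dotv0l.
have [r rP] := exists_gt_seq
  [:: 0, N / `|d| & [seq g i / dotv (c i) d | i <- enum I]].
have r0 : 0 < r by apply: rP; rewrite inE eqxx.
exists (r *: d) => [|i ci0].
  by rewrite normrZ gtr0_norm // -ltr_pdivrMr // rP // !inE eqxx orbT.
have cd0 : dotv (c i) d != 0.
  by apply: dP; rewrite inE map_f ?orbT // mem_filter ci0 mem_enum.
have : g i / dotv (c i) d < r.
  by apply: rP; rewrite !inE (map_f (fun i => _)) ?mem_enum ?orbT.
by apply: contraTneq => <-; rewrite dotvZr mulfK // ltxx.
Qed.

(** * Cells of a hyperplane arrangement *)

Section Cells.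
Variables (R : realType) (n : nat) (K : finType).
Variables (a : K -> 'cV[R]_n) (beta : K -> R).
Implicit Types (s : {ffun K -> bool}) (x p t w : 'cV[R]_n) (k l : K).

(* Cells of the arrangement of the hyperplanes [dotv (a k) x = beta k] are
   indexed by sign vectors; [true] stands for the side [dotv (a k) x <= beta k]. *)
Definition slack s k x : R := (-1) ^+ s k * (dotv (a k) x - beta k).
Definition slope s k t : R := (-1) ^+ s k * dotv (a k) t.
Definition open_cell s : set 'cV[R]_n := [set x | forall k, 0 < slack s k x].
Definition closed_cell s : set 'cV[R]_n := [set x | forall k, 0 <= slack s k x].
Definition on_wall p k : bool := dotv (a k) p == beta k.
(** The cell opposite to [s] at [p]; all hyperplanes through [p] are flipped at once because several
    indices may describe the same one. *)
Definition flip s p : {ffun K -> bool} := [ffun k => s k (+) on_wall p k].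

Lemma slackD s k x r t : slack s k (x + r *: t) = slack s k x + r * slope s k t.
Proof. by rewrite /slack /slope dotvDr dotvZr; ring. Qed.

Lemma slack_eq0 s k x : (slack s k x == 0) = on_wall x k.
Proof. by rewrite mulf_eq0 signr_eq0 /= subr_eq0. Qed.

Lemma open_cellW s : open_cell s `<=` closed_cell s.
Proof. by move=> x xs k; apply/ltW/xs. Qed.

Lemma flipK s p : flip (flip s p) p = s.
Proof. by apply/ffunP => k; rewrite !ffunE -addbA addbb addbF. Qed.

Lemma slack_flip s p k x :
  slack (flip s p) k x = (-1) ^+ on_wall p k * slack s k x.
Proof. by rewrite /slack ffunE signr_addb mulrA [_ * (-1) ^+ s k]mulrC. Qed.

Lemma slope_flip s p k t :
  slope (flip s p) k t = (-1) ^+ on_wall p k * slope s k t.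
Proof. by rewrite /slope ffunE signr_addb mulrA [_ * (-1) ^+ s k]mulrC. Qed.

Lemma closed_cell_flip s p : closed_cell s p -> closed_cell (flip s p) p.
Proof.
move=> ps k; rewrite slack_flip; have [|_] := boolP (on_wall p k).
  by rewrite -(slack_eq0 s) => /eqP ->; rewrite mulr0.
by rewrite mul1r.
Qed.

(** Backwards along [t] only slacks of positive slope decrease; the smallest ratio of slack to slope
    is the first hitting time. *)
Lemma cell_entry s x t : open_cell s x ->
  (forall r, 0 <= r -> closed_cell s (x - r *: t)) \/
  exists2 r, 0 < r & [/\ closed_cell s (x - r *: t),
    exists k, on_wall (x - r *: t) k &
    forall k, on_wall (x - r *: t) k -> 0 < slope s k t].
Proof.
move=> xs; have sB r k : slack s k (x - r *: t) = slack s k x - r * slope s k t.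
  by rewrite -scaleNr slackD mulNr.
have [[k0 k0P]|nok] := pselect (exists k, 0 < slope s k t); last first.
  left=> r r0 k; rewrite sB subr_ge0; apply: (@le_trans _ _ 0); last exact/ltW/xs.
  rewrite mulr_ge0_le0 // leNgt; apply/negP => kP; apply: nok; by exists k.
right; case: (@arg_minP _ R _ k0 (fun k => 0 < slope s k t)
  (fun k => slack s k x / slope s k t)) => // k kP kmin.
have r0 : 0 < slack s k x / slope s k t by rewrite divr_gt0.
exists (slack s k x / slope s k t) => //; split.
- move=> l; rewrite sB subr_ge0; have [lP|lP] := ltP 0 (slope s l t).
    by rewrite -ler_pdivlMr // kmin.
  by apply: (@le_trans _ _ 0); [rewrite mulr_ge0_le0 // ltW|exact/ltW/xs].
- by exists k; rewrite -(slack_eq0 s) sB mulfVK ?subrr // gt_eqF.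
- move=> l; rewrite -(slack_eq0 s) sB subr_eq0 => /eqP lE.
  by rewrite -(pmulr_rgt0 _ r0) -lE.
Qed.

Lemma open_cell_flip s p t : closed_cell s p ->
  (forall k, on_wall p k -> 0 < slope s k t) ->
  exists2 d, 0 < d & forall r, 0 < r <= d -> open_cell (flip s p) (p - r *: t).
Proof.
move=> ps pt.
have [k|d d0 dP] := @small_perturbation R K
  (* The value 1 is a dummy for the walls at [p], whose slack vanishes and is treated separately. *)
  (fun k => if on_wall p k then 1 else slack s k p) (fun k => - slope s k t).
  by case: ifPn => // pk; rewrite lt_neqAle eq_sym slack_eq0 pk ps.
exists d => // r /andP[r0 rd] k; rewrite -scaleNr slackD slack_flip slope_flip.
have := dP k r; rewrite (ltW r0) rd => /(_ isT).
have [pk _|_] := boolP (on_wall p k); last by rewrite !mul1r mulNr mulrN.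
have /eqP -> : slack s k p == 0 by rewrite slack_eq0.
by rewrite mulr0 add0r mulN1r mulrNN mulr_gt0 // pt.
Qed.

Lemma closed_cell_wall s p w : closed_cell s p ->
  (forall k, on_wall p k -> dotv (a k) w = 0) ->
  exists2 d, 0 < d & forall r, 0 <= r <= d -> closed_cell s (p + r *: w).
Proof.
move=> ps pw.
have [k|d d0 dP] := @small_perturbation R K
  (fun k => if on_wall p k then 1 else slack s k p) (fun k => slope s k w).
  by case: ifPn => // pk; rewrite lt_neqAle eq_sym slack_eq0 pk ps.
exists d => // r rd k; rewrite slackD.
have := dP k r rd; have [pk _|_ /ltW//] := boolP (on_wall p k).
by rewrite /slope pw // !mulr0 addr0.
Qed.

End Cells.

(** * Following the preimage of a line through the cells *)

Section LineFollowing.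
Variables (R : realType) (n : nat) (K : finType).
Variables (a : K -> 'cV[R]_n) (beta : K -> R).
Variables (F : 'cV[R]_n -> 'cV[R]_n).
Notation cell := {ffun K -> bool}.
Variables (B : cell -> 'M[R]_n) (b : cell -> 'cV[R]_n) (eps : R).
Variables (x0 y : 'cV[R]_n).
Let e : 'cV[R]_n := F x0 - y.
Notation ocell := (open_cell a beta).
Notation ccell := (closed_cell a beta).
Notation wall := (on_wall a beta).

Hypothesis F_cell : forall s, ocell s !=set0 ->
  forall x, ccell s x -> F x = B s *m x + b s.
Hypothesis F_neq : forall x, F x <> y.
Hypothesis eps_neq0 : eps != 0.
Hypothesis line_generic : forall s x r k l, ocell s !=set0 -> ccell s x ->
  F x = y + r *: e -> wall x k -> wall x l -> exists q, a l = q *: a k.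
Hypothesis x0_generic : forall k, ~~ wall x0 k.
Hypothesis det_far : forall s x r, ocell s !=set0 -> ccell s x ->
  F x = y + r *: e -> 1 <= r -> 0 < eps * \det (B s).
Hypothesis det_ray : forall s (x t : 'cV[R]_n), ocell s !=set0 -> t != 0 ->
  (forall r, 0 <= r -> ccell s (x - r *: t)) -> 0 < eps * \det (B s).

Implicit Types (s : cell) (p x t w : 'cV[R]_n) (k l : K) (r : R).

(** The factor [eps] carries the determinant sign, so that [F] advances in direction [e] along
    [dir s] where [speed s] is positive. *)
Let dir s : 'cV[R]_n := eps *: (\adj (B s) *m e).
Let speed s : R := eps * \det (B s).

Lemma mul_dir s : B s *m dir s = speed s *: e.
Proof. by rewrite -scalemxAr mulmxA mul_mx_adj mul_scalar_mx scalerA. Qed.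

Lemma F_along s x r (q : R) : ocell s !=set0 -> ccell s x ->
  ccell s (x + q *: dir s) -> F x = y + r *: e ->
  F (x + q *: dir s) = y + (r + q * speed s) *: e.
Proof.
move=> s0 xs xs' Fx; rewrite (F_cell s0 xs') mulmxDr addrAC -F_cell // Fx.
by rewrite -scalemxAr mul_dir scalerA scalerDl addrA.
Qed.

Lemma line_neq0 x r : F x = y + r *: e -> r != 0.
Proof.
move=> Fx; apply/eqP => r0; apply: (@F_neq x).
by rewrite Fx r0 scale0r addr0.
Qed.

Lemma line_param_inj r (q : R) : y + r *: e = y + q *: e -> r = q.
Proof.
move=> /addrI/eqP; rewrite -subr_eq0 -scalerBl scaler_eq0 subr_eq0.
by case/orP=> [/eqP//|/eqP e0]; case: (@F_neq x0); apply/eqP; rewrite -subr_eq0 -/e e0.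
Qed.

Lemma line_in_cell s p (q : 'cV[R]_n) r1 r2 : ocell s !=set0 -> dir s != 0 ->
  ccell s p -> ccell s q -> F p = y + r1 *: e -> F q = y + r2 *: e ->
  exists d, q = p + d *: dir s.
Proof.
move=> s0 d0 ps qs Fp Fq.
have : B s *m (q - p) = (r2 - r1) *: e.
  rewrite mulmxBr scalerBl -[LHS](addrKA (b s)) -!(addrC (b s)).
  rewrite -!(addrC _ (b s)) -!F_cell // Fp Fq.
  by rewrite opprD addrACA subrr add0r.
have /adj_direction_unique H : \adj (B s) *m e != 0.
  by apply: contra_neq d0 => adj0; rewrite /dir adj0 scaler0.
move=> /H[d dE]; exists (d / eps).
by rewrite /dir scalerA divfK // -dE addrC subrK.
Qed.

(* Cells met by the part of the preimage of the line lying over the open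
   half-line from [y] through [F x0]. *)
Definition visited s := dir s != 0 /\
  exists x r, [/\ ocell s x, 0 < r & F x = y + r *: e].

Definition entry s p (r : R) := [/\ ccell s p, F p = y + r *: e, 0 < r,
  exists k, wall p k & forall k, wall p k -> 0 < slope a s k (dir s)].

(** One wall of negative slope suffices: the trajectory cannot stay in the cell beyond [p]. *)
Definition exit s p := [/\ ccell s p, exists r, F p = y + r *: e &
  exists2 k, wall p k & slope a s k (dir s) < 0].

Lemma visited_open s : visited s -> ocell s !=set0.
Proof. by move=> [_ [x [r [xs _ _]]]]; exists x. Qed.

Lemma entry_exists s : visited s -> exists p r, entry s p r.
Proof.
move=> vs; have s0 := visited_open vs; case: vs => d0 [x [r [xs r0 Fx]]].
have xs' := open_cellW xs.
have [ray|[q q0 [qs qk kpos]]] := cell_entry (dir s) xs.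
  have D0 : 0 < speed s by exact: det_ray ray.
  have q0 : 0 <= r / speed s by rewrite divr_ge0 // ltW.
  have := ray _ q0; rewrite -scaleNr => rs.
  have := F_along s0 xs' rs Fx; rewrite mulNr divfK ?gt_eqF // subrr scale0r addr0.
  by move/F_neq.
have qs' := qs; rewrite -scaleNr in qs'.
have Fq := F_along s0 xs' qs' Fx; rewrite mulNr in Fq.
suff r1 : 0 < r - q * speed s.
  by exists (x - q *: dir s), (r - q * speed s); split=> //; rewrite -scaleNr.
(* With a negative parameter at the wall, the parameter would vanish at an intermediate point, which
   lies in the cell by convexity and is mapped to [y]. *)
rewrite lt_neqAle eq_sym (line_neq0 Fq) leNgt; apply/negP => neg.
have D0 : 0 < speed s by nra.
have [z0 zq] : 0 < r / speed s /\ r / speed s < q.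
  by rewrite divr_gt0 // ltr_pdivrMr //; split=> //; lra.
have zs : ccell s (x + - (r / speed s) *: dir s).
  move=> k; rewrite slackD; have := qs' k; rewrite slackD; have := xs k.
  set u := slack _ _ _ _ _; set v := slope _ _ _ _; move: (r / _) z0 zq => z.
  by move=> *; nra.
have := F_along s0 xs' zs Fx; rewrite mulNr divfK ?gt_eqF // subrr scale0r addr0.
by move/F_neq.
Qed.

(** Near [p] the common hyperplane lies in both closed cells, where both affine maps equal [F]; so
    the linear parts agree along it. *)
Lemma dotv_dir_flip s p r k : ocell s !=set0 -> ocell (flip a beta s p) !=set0 ->
  ccell s p -> F p = y + r *: e -> wall p k ->
  dotv (a k) (dir (flip a beta s p)) = dotv (a k) (dir s).
Proof.
set s' := flip a beta s p => s0 s0' ps Fp pk.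
have ps' : ccell s' p by exact: closed_cell_flip.
rewrite !dotvZr; congr (_ * _); apply: dotv_adj_crossing => w kw.
have pw l : wall p l -> dotv (a l) w = 0.
  by move=> /(line_generic s0 ps Fp pk)[q ->]; rewrite dotvZl kw mulr0.
have [d d0 dP] := closed_cell_wall ps pw.
have [d' d0' dP'] := closed_cell_wall ps' pw.
pose m := Num.min d d'; have m0 : 0 < m by rewrite lt_min d0.
have ms : ccell s (p + m *: w) by apply: dP; rewrite ltW // ge_min lexx.
have ms' : ccell s' (p + m *: w) by apply: dP'; rewrite ltW // ge_min lexx orbT.
apply: (scalerI (lt0r_neq0 m0)).
have := F_cell s0 ms; rewrite (F_cell s0' ms') !mulmxDr addrAC -(F_cell s0' ps').
by rewrite addrAC -(F_cell s0 ps) -!scalemxAr => /addrI.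
Qed.

Lemma visited_flip s p r : visited s -> entry s p r ->
  visited (flip a beta s p) /\ exit (flip a beta s p) p.
Proof.
set s' := flip a beta s p => vs [ps Fp r0 [k pk] kpos].
have s0 := visited_open vs; have ps' : ccell s' p by exact: closed_cell_flip.
have s0' : ocell s' !=set0.
  have [d d0 dP] := open_cell_flip ps kpos.
  by exists (p - d *: dir s); apply: dP; rewrite d0 lexx.
have kd l : wall p l -> slope a s l (dir s') = slope a s l (dir s).
  by move=> pl; rewrite /slope (dotv_dir_flip s0 s0' ps Fp pl).
have d0' : dir s' != 0.
  apply: contraTneq (kpos _ pk) => d0.
  by rewrite -kd // d0 /slope dotvC dotv0l mulr0 ltxx.
have [l pl|d d0 dP] := open_cell_flip (t := dir s') ps; first by rewrite kd // kpos.
split; last first.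
  split=> //; first by exists r.
  by exists k => //; rewrite slope_flip pk mulN1r oppr_lt0 kd // kpos.
split=> //.
(* Just before [p] the trajectory is in the open cell [s']; [m] keeps the line parameter positive
   there. *)
have [_|m m0 mP] := @small_perturbation R unit (fun=> r) (fun=> - speed s') => //.
pose q := Num.min d m; have q0 : 0 < q by rewrite lt_min d0.
have qs : ocell s' (p - q *: dir s') by apply: dP; rewrite q0 ge_min lexx.
exists (p - q *: dir s'), (r + q * - speed s'); split=> //.
  by apply: mP => //; rewrite ltW // ge_min lexx orbT.
rewrite -scaleNr mulrN -mulNr; apply: F_along => //.
by rewrite scaleNr; exact: open_cellW.
Qed.

Lemma exit_last s p (q : 'cV[R]_n) (d : R) : exit s p -> ccell s q ->
  q = p + d *: dir s -> d <= 0.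
Proof.
move=> [_ _ [k pk ks]] /(_ k) qs qE; move: qs.
have /eqP p0 : slack a beta s k p == 0 by rewrite slack_eq0.
by rewrite qE slackD p0 add0r nmulr_lge0.
Qed.

Lemma exit_unique s p (q : 'cV[R]_n) : visited s -> exit s p -> exit s q -> p = q.
Proof.
move=> vs ep eq; have s0 := visited_open vs; case: vs => d0 _.
have [[ps [r1 Fp] _] [qs [r2 Fq] _]] := (ep, eq).
have [d dE] := line_in_cell s0 d0 ps qs Fp Fq.
have d_le : d <= 0 := exit_last ep qs dE.
have Nd_le : - d <= 0.
  by apply: (exit_last eq ps); rewrite dE scaleNr addrK.
have d00 : d = 0 by lra.
by rewrite dE d00 scale0r addr0.
Qed.

Lemma line_following_contradiction : False.
Proof.
have /choice[P PE] : forall s, exists pr : 'cV[R]_n * R,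
    visited s -> entry s pr.1 pr.2.
  move=> s; have [/entry_exists[p [r pr]]|ns] := pselect (visited s).
    by exists (p, r).
  by exists (0, 0) => /ns.
(* The predecessor map: the trajectory enters [s] from [f s]. *)
pose f s := flip a beta s (P s).1.
pose S := finset (fun s => `[< visited s >]).
have inS s : reflect (visited s) (s \in S) by rewrite inE; exact: asboolP.
have fS s : visited s -> visited (f s) /\ exit (f s) (P s).1.
  by move=> vs; exact: visited_flip (PE s vs).
(* Equal images have the same exit point, and flipping back at this point recovers the cell. *)
have f_inj : {in S &, injective f}.
  move=> s s' /inS vs /inS vs' ff.
  have [vf ef] := fS s vs; have [_ ef'] := fS s' vs'.
  have PP' : (P s).1 = (P s').1 by apply: (exit_unique vf ef); rewrite ff.
  by rewrite -(flipK a beta s (P s).1) -/(f s) ff /f PP' flipK.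
have f_onto s : visited s -> exists2 s', visited s' & f s' = s.
  move=> /inS; have -> : S = (f @: S)%SET.
    apply/esym/eqP; rewrite eqEcard card_in_imset // leqnn andbT.
    by apply/fintype.subsetP => _ /imsetP[u /inS vu ->]; apply/inS; case: (fS u vu).
  by case/imsetP => s' /inS vs' ->; exists s'.
pose s0 : cell := [ffun k => dotv (a k) x0 < beta k].
have x0s : ocell s0 x0.
  move=> k; rewrite /slack ffunE; have := x0_generic k; rewrite /on_wall.
  case: (ltP (dotv (a k) x0)) => [h _|h ne].
    by rewrite expr1 mulN1r oppr_gt0 subr_lt0.
  by rewrite expr0 mul1r subr_gt0 lt_neqAle eq_sym ne h.
have s00 : ocell s0 !=set0 by exists x0.
have Fx0 : F x0 = y + 1 *: e by rewrite scale1r addrC subrK.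
have e0 : e != 0 by rewrite subr_eq0; apply/eqP/F_neq.
have vs0 : visited s0.
  split; last by exists x0, 1; split.
  apply: contraTneq (det_far s00 (open_cellW x0s) Fx0 (lexx _)) => d0.
  have /eqP := mul_dir s0; rewrite d0 mulmx0 eq_sym scaler_eq0 (negPf e0) orbF.
  by rewrite /speed => /eqP ->; rewrite ltxx.
(* The preimage [s'] of [s] under [f] is its successor: the entry point of [s'] is the exit point of
   [s]. *)
have advance s p r : visited s -> ccell s p -> F p = y + r *: e -> 1 <= r ->
    exists s' (d : R), [/\ visited s', 0 <= d /\ 0 < speed s, exit s (P s').1,
      (P s').1 = p + d *: dir s & (P s').2 = r + d * speed s].
  move=> vs ps Fp r1; have so := visited_open vs.
  have [s' vs' fs'] := f_onto s vs; exists s'.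
  have [_] := fS s' vs'; rewrite fs' => ex.
  have [qs [r' Fq] _] := ex; have [_ Fq' _ _ _] := PE s' vs'.
  have [d dE] := line_in_cell so (proj1 vs) ps qs Fp Fq.
  exists d; split=> //.
  - split; last exact: det_far ps Fp r1.
    by rewrite -oppr_le0; apply: (exit_last ex ps); rewrite dE scaleNr addrK.
  - apply: line_param_inj; rewrite -Fq' dE; apply: F_along => //.
    by rewrite -dE.
have [s1 [d [vs1 [d0 sp] _ _ rE]]] := advance _ _ _ vs0 (open_cellW x0s) Fx0 (lexx _).
have [s2 /inS vs2 smax] := arg_maxP (fun s => (P s).2) (introT (inS s1) vs1).
have r2 : 1 <= (P s2).2.
  apply: le_trans (smax s1 (introT (inS s1) vs1)).
  by rewrite /= rE lerDl mulr_ge0 // ltW.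
have [ps2 Fp2 _ [k pk] kpos] := PE s2 vs2.
have [s3 [d3 [vs3 [d30 sp2] [_ _ [l pl lneg]] p3 r3]]] :=
  advance _ _ _ vs2 ps2 Fp2 r2.
(* At the entry point all walls have positive slope, at the exit point one has negative slope, so
   the points differ. *)
have d3_neq0 : d3 != 0.
  apply: contraTneq lneg => d3_0; move: pl; rewrite p3 d3_0 scale0r addr0 => /kpos.
  by rewrite -leNgt => /ltW.
have := smax s3 (introT (inS s3) vs3); rewrite r3 => /=.
by rewrite gerDl leNgt mulr_gt0 // lt_neqAle eq_sym d3_neq0.
Qed.

End LineFollowing.

(** * Norm bounds and halfspace descriptions *)

Lemma norm_mulmx_bound (R : realType) m n (A : 'M[R]_(m, n)) :
  exists C : R, 0 <= C /\ forall x : 'cV[R]_n, `|A *m x| <= C * `|x|.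
Proof.
have C0 : 0 <= \sum_i \sum_j `|A i j| by do 2!apply: sumr_ge0 => ? _.
exists (\sum_i \sum_j `|A i j|); split=> // x.
rewrite [leLHS]mx_normrE; apply: bigmax_le => [|[i k] _ /=].
  by rewrite mulr_ge0.
rewrite mxE; apply: le_trans (ler_norm_sum _ _ _) _.
apply: (@le_trans _ _ (\sum_j `|A i j| * `|x|)).
  apply: ler_sum => j _; rewrite normrM ler_wpM2l // [leRHS]mx_normrE.
  exact: (le_bigmax _ (fun ij => `|x ij.1 ij.2|) (j, k)).
rewrite -mulr_suml ler_wpM2r // (bigD1 i) //= lerDl.
by do 2!apply: sumr_ge0 => ? _.
Qed.

Definition halfspaces (R : realType) n (hs : seq ('cV[R]_n * R)) : set 'cV[R]_n :=
  [set x | forall h, h \in hs -> dotv h.1 x <= h.2].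

Lemma polyhedron_halfspaces (R : realType) n (P : set 'cV[R]_n) :
  is_polyhedron P -> P !=set0 ->
  exists2 hs : seq ('cV[R]_n * R), forall h, h \in hs -> h.1 != 0 & P = halfspaces hs.
Proof.
move=> [k [a [beta PE]]] [z Pz].
exists [seq (a i, beta i) | i <- enum 'I_k & a i != 0].
  by move=> _ /mapP[i + ->]; rewrite mem_filter => /andP[].
rewrite PE; apply/seteqP; split=> x Px.
  by move=> _ /mapP[i _ ->]; exact: Px.
move=> i; have [ai0|ai0] := eqVneq (a i) 0.
  by move: Pz; rewrite PE => /(_ i); rewrite ai0 !dotv0l.
by apply: (Px (a i, beta i)); rewrite (map_f (fun i => _)) // mem_filter ai0 mem_enum.
Qed.

Lemma polyhedra_halfspaces (R : realType) n (PP : set (set 'cV[R]_n)) :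
  finite_set PP -> (forall P, PP P -> is_polyhedron P) ->
  (forall P, PP P -> P !=set0) ->
  exists2 hs : seq ('cV[R]_n * R), forall h, h \in hs -> h.1 != 0 &
    forall P, PP P ->
      exists2 hp : seq ('cV[R]_n * R), {subset hp <= hs} & P = halfspaces hp.
Proof.
move=> /finite_seqP[s ->]; elim: s => [|P s IH] poly ne; first by exists [::].
have [Q Qs|Q Qs|hs hs0 hsP] := IH.
- by apply: poly; rewrite /= inE Qs orbT.
- by apply: ne; rewrite /= inE Qs orbT.
have Ps : P \in P :: s by rewrite mem_head.
have [hp hp0 PE] := polyhedron_halfspaces (poly P Ps) (ne P Ps).
exists (hp ++ hs) => [h|Q /=].
  by rewrite mem_cat => /orP[/hp0|/hs0].
rewrite inE => /predU1P[->|/hsP[hq hqs ->]].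
  by exists hp => // h hh; rewrite mem_cat hh.
by exists hq => // h /hqs hh; rewrite mem_cat hh orbT.
Qed.

Lemma bounded_members_bound (R : realType) n (PP : set (set 'cV[R]_n)) :
  finite_set PP -> exists N : R,
    forall P, PP P -> bounded_set P -> forall x, P x -> `|x| <= N.
Proof.
move=> /finite_seqP[s ->]; elim: s => [|P s [N NP]]; first by exists 0.
have [bP|nbP] := pselect (bounded_set P); last first.
  by exists N => Q /=; rewrite inE => /predU1P[->|/NP].
have [N' N'P] : exists N', forall x, P x -> `|x| <= N'.
  by case: bP => M [_ /(_ (M + 1))]; rewrite ltrDl ltr01 => /(_ isT) h; exists (M + 1).
exists (Num.max N N') => Q /=; rewrite inE => /predU1P[->|/NP Qs] bQ x Qx.
  by rewrite le_max N'P ?orbT.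
by rewrite le_max Qs.
Qed.

(** * Choice of a generic line and reduction to cells *)

Theorem proposition3p6 (R : realType) (n m : nat)
    (F : 'cV[R]_n -> 'cV[R]_n) (A : 'I_m -> 'M[R]_n) (b : 'I_m -> 'cV[R]_n)
    (PP : set (set 'cV[R]_n))
    (F_pwa : piecewise_affine F A b)
    (PP_subdiv : polyhedral_subdivision F A b PP)
    (same_sign :
      (forall (P : set 'cV[R]_n) (i : 'I_m), PP P -> ~ bounded_set P ->
         active_on F (affine_fun (A i) (b i)) P -> 0 < \det (A i)) \/
      (forall (P : set 'cV[R]_n) (i : 'I_m), PP P -> ~ bounded_set P ->
         active_on F (affine_fun (A i) (b i)) P -> \det (A i) < 0)) :
  set_surj [set: 'cV[R]_n] [set: 'cV[R]_n] F.
Proof.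
move=> y _; apply: contrapT => ny.
have Fy x : F x <> y by move=> Fx; apply: ny; exists x.
case: n => [|n] in F A b PP F_pwa PP_subdiv same_sign y ny Fy *.
  by apply: (Fy 0); rewrite [LHS]flatmx0 [RHS]flatmx0.
have [eps eps0 det_pos] : exists2 eps : R, eps != 0 & forall P i, PP P ->
    ~ bounded_set P -> active_on F (affine_fun (A i) (b i)) P ->
    0 < eps * \det (A i).
  case: same_sign => pos; first by exists 1 => // P i *; rewrite mul1r (pos P).
  by exists (-1) => [|P i *]; rewrite ?oppr_eq0 // mulN1r oppr_gt0 (pos P).
have [fin poly dimn cover active _ _] := PP_subdiv.
have [|hs hs0 hsP] := polyhedra_halfspaces fin poly.
  by move=> P /dimn[[x [/(_ ord0) Px _]] _]; exists (x ord0).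
pose K : finType := 'I_(size hs).
pose a (k : K) := (tnth (in_tuple hs) k).1.
pose beta (k : K) := (tnth (in_tuple hs) k).2.
have a0 k : a k != 0 by apply/hs0/mem_tnth.
have coverP x : exists2 P, PP P & P x.
  by have : setT x by []; rewrite -cover => -[P PPP Px]; exists P.
have activeP P : PP P -> exists i, forall x, P x -> F x = A i *m x + b i.
  by move=> /active[i Pi]; exists i => x Px; apply: Pi; rewrite inE.
have [N1 N1P] := bounded_members_bound fin.
have [M MP] : exists M : R, forall x, `|x| <= N1 -> `|F x - y| <= M.
  have /choice[C CP] := fun i => norm_mulmx_bound (A i).
  have [r rP] := exists_gt_seq [seq C i * N1 + `|b i - y| | i <- enum 'I_m].
  exists r => x xN; have [P /activeP[i iP] Px] := coverP x; rewrite iP // -addrA.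
  have := rP _ (map_f (fun i => C i * N1 + `|b i - y|) (mem_enum 'I_m i)).
  move/ltW; apply: le_trans; apply: le_trans (ler_normD _ _) _.
  have [Ci /(_ x) Cx] := CP i.
  by rewrite lerD2r; apply: le_trans Cx _; rewrite ler_wpM2l.
(* Beyond [N2] every invertible selection function takes values farther from [y] than [F] does on
   bounded polyhedra. *)
have [N2 N2P] : exists N : R, forall i x, \det (A i) != 0 -> N < `|x| ->
    M < `|A i *m x + b i - y|.
  have /choice[C CP] := fun i => norm_mulmx_bound (invmx (A i)).
  have [r rP] := exists_gt_seq [seq C i * (M + `|b i - y|) | i <- enum 'I_m].
  exists r => i x detA xr; rewrite ltNge; apply/negP => le_M.
  have := rP _ (map_f (fun i => C i * (M + `|b i - y|)) (mem_enum 'I_m i)).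
  have [Ci /(_ (A i *m x)) Cx] := CP i.
  move: Cx; rewrite mulKmx ?unitmxE ?unitfE // => Cx ltr.
  have : C i * `|A i *m x| <= C i * (M + `|b i - y|).
    rewrite ler_wpM2l // -[A i *m x](addrK (b i - y)).
    by apply: le_trans (ler_normB _ _) _; rewrite lerD2r addrA.
  lra.
(* [c] is normal to a hyperplane through [y] containing the image of a codimension 2 flat; the
   default is 0 for proportional normals. *)
have /choice[c cP] : forall u : 'I_m * (K * K), exists c : 'cV[R]_n.+1,
    (forall r, a u.2.2 <> r *: a u.2.1) -> c != 0 /\
    forall x, dotv (a u.2.1) x = beta u.2.1 -> dotv (a u.2.2) x = beta u.2.2 ->
      dotv c (A u.1 *m x + b u.1) = dotv c y.
  move=> [i [k l]] /=.
  have [/(flat_image_hyperplane (A i) (b i) y (beta k) (beta l) (a0 k))[c ? ?]|h] :=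
    pselect (forall r, a l <> r *: a k).
    by exists c.
  by exists 0 => /h.
(* The point [x0] has to avoid the arrangement and the preimages of the hyperplanes normal to [c u],
   for every [j], as the piece active at [x0] is not yet known. *)
pose wall_of (v : K + ('I_m * ('I_m * (K * K)))) : 'cV[R]_n.+1 * R :=
  match v with
  | inl k => (a k, beta k)
  | inr (j, u) => ((A j)^T *m c u, dotv (c u) y - dotv (c u) (b j))
  end.
have [x0 x0N x0P] := generic_point (fun v => (wall_of v).1)
  (fun v => (wall_of v).2) (Num.max N1 N2).
move: x0N; rewrite gt_max => /andP[x0N1 x0N2].
have unboundedP P x : PP P -> P x -> N1 < `|x| -> ~ bounded_set P.
  by move=> PPP Px xN /(N1P P PPP)/(_ x Px); rewrite leNgt xN.
have [j [detj Fx0]] : exists j, \det (A j) != 0 /\ F x0 = A j *m x0 + b j.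
  have [P PPP Px0] := coverP x0; have [j jP] := active P PPP; exists j; split.
    apply: contraTneq (det_pos P j PPP (unboundedP _ _ PPP Px0 x0N1) jP) => ->.
    by rewrite mulr0 ltxx.
  by apply: jP; rewrite inE.
have far : M < `|F x0 - y| by rewrite Fx0; exact: N2P.
have c_far u : c u != 0 -> dotv (c u) (F x0) != dotv (c u) y.
  move=> cu0; have := x0P (inr (j, u)); rewrite /= -dotvMr Fx0 dotvDr => cx0.
  apply: contraNneq (cx0 _) => [<-|]; first by rewrite addrK.
  apply: contraNneq cu0 => /(congr1 (mulmx (invmx (A j)^T))).
  by rewrite mulKmx ?mulmx0 ?unitmx_tr ?unitmxE ?unitfE // => ->.
have /choice[D DP] : forall s : {ffun K -> bool}, exists D : set 'cV[R]_n.+1 * 'I_m,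
    open_cell a beta s !=set0 -> [/\ PP D.1,
      active_on F (affine_fun (A D.2) (b D.2)) D.1 & closed_cell a beta s `<=` D.1].
  move=> s; have [[z zs]|ns] := pselect (open_cell a beta s !=set0); last first.
    by exists (setT, j) => /ns.
  have [P PPP Pz] := coverP z; have [i iP] := active P PPP.
  exists (P, i) => _; split=> //= x xs.
  (* All bounding hyperplanes of [P] are in the arrangement, so one point of the open cell in [P]
     puts the closed cell into [P]. *)
  have [hp hps PE] := hsP P PPP; move: Pz; rewrite PE => Pz h hhp.
  have /tnthP[k kE] : h \in in_tuple hs := hps h hhp.
  have := Pz h hhp; have := xs k; have := zs k.
  rewrite /slack /a /beta -kE; case: (s k); rewrite ?expr1 ?expr0; lra.
apply: (@line_following_contradiction R n.+1 K a beta F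
  (A \o snd \o D) (b \o snd \o D) eps x0 y).
- move=> s /DP[_ act sub] x xs /=; by apply: act; rewrite inE; exact: sub.
- exact: Fy.
- exact: eps0.
- move=> s x r k l /DP[_ act sub] xs Fx /eqP xk /eqP xl.
  have FE : F x = A (D s).2 *m x + b (D s).2 by apply: act; rewrite inE; exact: sub.
  apply: contrapT => /forallNP nq; have [cu0 cu] := cP ((D s).2, (k, l)) nq.
  have := cu x xk xl; rewrite /= -FE Fx dotvDr dotvZr dotvBr => /eqP.
  (* By [c_far] the line meets the hyperplane through [y] normal to [c] only at [y]. *)
  rewrite -subr_eq0 addrAC subrr add0r mulf_eq0 subr_eq0 (negPf (c_far _ cu0)) orbF.
  by move=> /eqP r0; apply: (Fy x); rewrite Fx r0 scale0r addr0.
- move=> k; exact: (x0P (inl k) (a0 k)).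
- move=> s x r /DP[PPD act sub] xs Fx r1; apply: det_pos act => // bD.
  have := MP x (N1P _ PPD bD x (sub x xs)); rewrite Fx addrC addKr.
  rewrite normrZ leNgt ger0_norm ?(le_trans ler01) //; move/negP; apply.
  by apply: (lt_le_trans far); rewrite ler_peMl.
- move=> s x t /DP[PPD act sub] t0 ray; apply: det_pos act => // bD.
  have t_gt0 : 0 < `|t| by rewrite normr_gt0.
  (* At this time the ray has norm at least [|N1| + 1], beyond all bounded polyhedra. *)
  have q0 : 0 <= (`|x| + `|N1| + 1) / `|t| by rewrite divr_ge0 // !addr_ge0.
  have := N1P _ PPD bD _ (sub _ (ray _ q0)).
  have := lerB_dist ((`|x| + `|N1| + 1) / `|t| *: t) x.
  rewrite distrC normrZ ger0_norm // divfK ?gt_eqF //; have := ler_norm N1; lra.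
Qed.
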